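(* Let $D$ be a weighted oriented complete graph on the vertices $\{x_1,\dots,x_n\}$ (i.e. its underlying graph $G$ is the complete graph on these vertices), with $V^+\neq\emptyset$ and such that all elements of $V^+$ are sinks. Let $\tilde I=I(D)$ be its edge ideal. Then: (1) For any $s\ge n$, $$\tilde I^{(s)}=\sum_{\substack{(r_1,\dots,r_{n-1})\\ s=r_1+2r_2+\cdots+(n-1)r_{n-1}}}\tilde I^{\,r_1}\bigl(\tilde I^{(2)}\bigr)^{r_2}\cdots\bigl(\tilde I^{(n-1)}\bigr)^{r_{n-1}},$$ where the sum runs over tuples of non-negative integers. (2) If $n\ge3$, then for any $s\in\mathbb{N}$, $\alpha(\tilde I^{(s)})=s+\left\lceil\frac{s}{n-2}\right\rceil$. In particular, the Waldschmidt constant of $\tilde I$ is $\widehat{\alpha}(\tilde I)=\frac{n-1}{n-2}$.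
   Context: A weighted oriented graph $D=(V(D),E(D),w)$ consists of a finite simple graph $G$ (the underlying graph) on vertices $V(D)=\{x_1,\dots,x_n\}$, an orientation of each edge of $G$ (the pair $(x_i,x_j)\in E(D)$ denotes the edge directed from $x_i$ to $x_j$), and a weight function $w:V(D)\to\mathbb{N}=\{1,2,\dots\}$. If $x$ is a source (only arrows leaving $x$), one always assumes $w(x)=1$. Set $V^+=\{x\in V(D): w(x)\neq 1\}$. A vertex $x$ is a sink if all edges at $x$ are directed into $x$. Let $R=K[x_1,\dots,x_n]$ with $K$ a field (vertices are identified with variables). The edge ideal of $D$ is $I(D)=(x_ix_j^{w(x_j)} : (x_i,x_j)\in E(D))\subseteq R$. For a homogeneous ideal $I\subset R$, the $m$-th symbolic power is $I^{(m)}=\bigcap_{p\in \mathrm{Ass}(I)}(I^mR_p\cap R)$, the intersection being over all associated primes of $I$; any ideal to the power $0$ is $R$. For a nonzero homogeneous ideal $I$, $\alpha(I)=\min\{d: I_d\neq0\}$ is the smallest degree of a nonzero element of $I$ (with the standard grading), and the Waldschmidt constant is $\widehat{\alpha}(I)=\lim_{s\to\infty}\alpha(I^{(s)})/s$. *)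

(* Defs.v *)
From HB Require Import structures.
From mathcomp Require Export all_boot all_order all_algebra.
From mathcomp Require Export all_classical all_reals all_analysis.
(* The notations of mpoly clash with those of MathComp-Analysis, so the
   polynomial ring is written [mpoly n K] instead of {mpoly K[n]}. *)
From mathcomp Require Export -(notations) mpoly.
Export numFieldNormedType.Exports.
Export Order.TTheory GRing.Theory Num.Theory.

Set Implicit Arguments.
Unset Strict Implicit.
Unset Printing Implicit Defensive.

Local Open Scope classical_set_scope.
Local Open Scope ring_scope.

Definition lin_span (S : comNzRingType) (C A : set S) : set S :=
  [set x | exists s : seq (S * S),
     (forall c, c \in s -> C c.1 /\ A c.2) /\ x = \sum_(c <- s) c.1 * c.2].

Section Ideals.
Variable R : idomainType.
Implicit Types (I J p : set R).

Definition is_ideal I : Prop :=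
  [/\ I 0, (forall a b, I a -> I b -> I (a + b)) &
      (forall r a, I a -> I (r * a))].

Definition is_prime_ideal p : Prop :=
  [/\ is_ideal p, ~ p 1 & forall a b, p (a * b) -> p a \/ p b].

Definition ideal_gen (A : set R) : set R := lin_span setT A.

Definition ideal_mul I J : set R := ideal_gen [set a * b | a in I & b in J].

Definition ideal_exp I (m : nat) : set R := iter m (ideal_mul I) setT.

Definition ideal_sum (T : Type) (P : set T) (F : T -> set R) : set R :=
  ideal_gen (\bigcup_(t in P) F t).

(* Ass(I) = Ass(R/I): the primes that are annihilators of a class f + I. *)
Definition assoc_primes I : set (set R) :=
  [set p | is_prime_ideal p /\ exists f : R, p = [set g | I (g * f)]].

(* R_p, realised inside the fraction field of the domain R. *)
Definition localization p : set {fraction R} :=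
  [set x | exists a b : R, ~ p b /\ x = tofrac a / tofrac b].

Definition loc_extension I p : set {fraction R} :=
  lin_span (localization p) [set tofrac a | a in I].

Definition loc_contraction I p : set R :=
  [set f | loc_extension I p (tofrac f)].

Definition symbolic_power I (m : nat) : set R :=
  \bigcap_(p in assoc_primes I) loc_contraction (ideal_exp I m) p.

End Ideals.

Section Alpha.
Variables (n : nat) (K : fieldType).

Definition has_degree (I : set (mpoly n K)) (d : nat) : Prop :=
  exists f : mpoly n K, [/\ I f, f != 0 & f \is ishomog1 d (@mdeg n)].

(* Junk value 0 when I has no nonzero homogeneous element. *)
Definition alpha (I : set (mpoly n K)) : nat :=
  if pselect (exists d, `[< has_degree I d >]) is left h then ex_minn h else 0%N.

Definition waldschmidt_seq (R : realType) (I : set (mpoly n K)) : R^nat :=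
  fun s => (alpha (symbolic_power I s))%:R / s%:R.

Definition waldschmidt (R : realType) (I : set (mpoly n K)) : R :=
  limn (waldschmidt_seq R I).

End Alpha.

Arguments waldschmidt_seq {n K} R I _.
Arguments waldschmidt {n K} R I.

(* [arc x y] is the edge directed from x to y; the underlying simple graph is
   its symmetrization, and [arc_asym] says each edge has one orientation. *)
Record wograph (n : nat) := WOGraph {
  arc : rel 'I_n;
  weight : 'I_n -> nat;
  arc_irrefl : irreflexive arc;
  arc_asym : forall x y, arc x y -> ~~ arc y x;
  weight_gt0 : forall x, (0 < weight x)%N;
  weight_source : forall x, (forall y, ~~ arc y x) -> weight x = 1%N
}.

Section WOGraph.
Variables (n : nat) (D : wograph n).

Definition underlying : rel 'I_n := fun x y => arc D x y || arc D y x.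

Definition is_complete : Prop := forall x y, x != y -> underlying x y.

Definition is_sink (x : 'I_n) : Prop := forall y, ~~ arc D x y.

Definition Vplus : {set 'I_n} := [set x | weight D x != 1%N]%SET.

Definition var (K : fieldType) (x : 'I_n) : mpoly n K := mpolyX K (mnm1 x).

Definition edge_ideal (K : fieldType) : set (mpoly n K) :=
  ideal_gen [set f | exists x y, arc D x y /\
                     f = var K x * var K y ^+ weight D y].

End WOGraph.

Arguments edge_ideal {n} D K _.

(* Main.v *)
(* Since heads of weight greater than 1 are sinks, the tail of every arc has
   weight 1, so that I is generated by the products E_i E_j, i <> j, with
   E_i = X_i^(w_i). At the associated prime P_i = (X_j : j <> i) the variable
   X_i becomes invertible and I^s becomes (E_j : j <> i)^s, hence X^m lies in
   I^(s) iff s <= quo_off i m = sum_(j <> i) floor(m_j / w_j) for every i.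
   Part 1: splitting off from such a monomial the product of the E_j over its
   support T (or over s + 1 elements of T) lowers s by #|T| - 1 <= n - 1.
   Part 2: only one vertex z has weight greater than 1; summing the conditions
   over i <> z bounds the degree from below, and spreading s + ceil(s/(n-2))
   evenly over the other n - 1 variables attains the bound. *)
Require Import Defs.
From mathcomp Require Import zify.
Local Open Scope classical_set_scope.
Local Open Scope ring_scope.

Set Implicit Arguments.
Unset Strict Implicit.
Unset Printing Implicit Defensive.

(** * Generated ideals and localization at a prime *)

Section IdealTheory.
Variable R : idomainType.
Implicit Types (A I J p : set R).

Lemma ideal_gen_mem A a : A a -> ideal_gen A a.
Proof.
move=> Aa; exists [:: (1, a)]; split; last by rewrite big_seq1 mul1r.
by move=> c; rewrite inE => /eqP ->.
Qed.

Lemma ideal_gen_is_ideal A : is_ideal (ideal_gen A).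
Proof.
split.
- by exists [::]; split=> //; rewrite big_nil.
- move=> a b [s [sA ->]] [t [tA ->]]; exists (s ++ t); rewrite big_cat; split=> //.
  by move=> c; rewrite mem_cat => /orP[/sA|/tA].
- move=> r a [s [sA ->]]; exists [seq (r * c.1, c.2) | c <- s]; split.
    by move=> _ /mapP[c /sA[_ Ac] ->].
  by rewrite big_map mulr_sumr; apply: eq_bigr => c _; rewrite mulrA.
Qed.

Lemma ideal_sum_closed I (T : eqType) (s : seq T) (F : T -> R) :
  is_ideal I -> (forall x, x \in s -> I (F x)) -> I (\sum_(x <- s) F x).
Proof.
move=> [I0 ID _]; elim: s => [|x s IHs] sI; first by rewrite big_nil.
rewrite big_cons; apply: ID; first by apply: sI; rewrite mem_head.
by apply: IHs => y ys; apply: sI; rewrite in_cons ys orbT.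
Qed.

Lemma ideal_gen_sub A I : is_ideal I -> A `<=` I -> ideal_gen A `<=` I.
Proof.
move=> idI AI _ [s [sA ->]]; apply: ideal_sum_closed => // c /sA[_ /AI Ic].
by case: idI => _ _; apply.
Qed.

Lemma ideal_mul_mem I J a b : I a -> J b -> ideal_mul I J (a * b).
Proof. by move=> Ia Jb; apply: ideal_gen_mem; exists a => //; exists b. Qed.

Lemma ideal_exp_is_ideal I k : is_ideal (ideal_exp I k).
Proof. by case: k => [|k] //; exact: ideal_gen_is_ideal. Qed.

(** A finite sum of fractions has a common denominator, which stays outside [p] because [p] is
    prime. This replaces the fraction field by a multiplier [b] outside [p]. *)
Lemma loc_contractionP J p f : is_ideal J -> is_prime_ideal p ->
  loc_contraction J p f <-> exists2 b, ~ p b & J (b * f).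
Proof.
move=> idJ [[p0 _ _] p1 pM]; have [J0 JD JZ] := idJ.
have nz b : ~ p b -> tofrac b != 0.
  by move=> pb; rewrite tofrac_eq0; apply/eqP => b0; apply: pb; rewrite b0.
split=> [[s [sJ fE]]|[b pb Jbf]]; last first.
  exists [:: (tofrac 1 / tofrac b, tofrac (b * f))]; split.
    move=> c; rewrite inE => /eqP -> /=; split; last by exists (b * f).
    by exists 1, b.
  by rewrite big_seq1 /= tofracM tofrac1 mul1r mulKf // nz.
have [b [j [pb Jj sE]]] : exists b j, [/\ ~ p b, J j &
    \sum_(c <- s) c.1 * c.2 = tofrac j / tofrac b].
  elim: s sJ {fE} => [|c s IHs] sJ.
    by exists 1, 0; rewrite big_nil tofrac0 mul0r.
  have [|b [j [pb Jj sE]]] := IHs; first by move=> d ds; apply: sJ; rewrite in_cons ds orbT.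
  have [[a [d [pd c1E]]] [k Jk c2E]] := sJ c (mem_head _ _).
  exists (d * b), (a * k * b + j * d); split.
  - by move=> /pM[].
  - by apply: JD; rewrite mulrC; apply: (JZ) => //; apply: (JZ).
  - rewrite big_cons sE c1E -c2E tofracD !tofracM.
    by rewrite mulrAC addf_div ?nz.
exists b => //; rewrite -(_ : j = b * f) //; apply/eqP; rewrite -tofrac_eq tofracM fE sE.
by rewrite mulrC divfK // nz.
Qed.

End IdealTheory.

(** * Extremal elements of finite sequences *)

Lemma seq_argmin (T : eqType) (s : seq T) (P : pred T) (f : T -> nat) :
  has P s -> exists x, [/\ x \in s, P x &
    forall y, y \in s -> P y -> (f x <= f y)%N].
Proof.
move=> /hasP[x xs Px].
have /ex_minnP[k /hasP[y ys /andP[Py /eqP fy]] kmin] :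
    exists k, has (fun x => P x && (f x == k)) s.
  by exists (f x); apply/hasP; exists x; rewrite ?Px /=.
exists y; split=> // z zs Pz; rewrite fy; apply: kmin.
by apply/hasP; exists z; rewrite ?Pz /=.
Qed.

Lemma seq_argmax (T : eqType) (s : seq T) (P : pred T) (f : T -> nat) :
  has P s -> exists x, [/\ x \in s, P x &
    forall y, y \in s -> P y -> (f y <= f x)%N].
Proof.
move=> /(@seq_argmin _ _ _ (fun x => \max_(y <- s) f y - f x)%N)[x [xs Px xmin]].
exists x; split=> // y ys Py; have := xmin y ys Py.
have le z : z \in s -> (f z <= \max_(y <- s) f y)%N by move=> zs; apply: leq_bigmax_seq.
by move: (le x xs) (le y ys); lia.
Qed.

(** * Monomial ideals and cancellation modulo the primes [P_i] *)

Section MonomialSpan.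
Variables (n : nat) (K : fieldType).
Implicit Types (m k : multinom n) (c : pred (multinom n)) (f b : mpoly n K).

(** A monomial ideal as soon as [c] is stable under adding exponents. *)
Definition monomial_span c : set (mpoly n K) := [set f | forall m, m \in msupp f -> c m].

Lemma monomial_spanX c m : monomial_span c (mpolyX K m) <-> c m.
Proof.
split=> [|cm k]; first by apply; rewrite msuppX inE.
by rewrite msuppX inE => /eqP ->.
Qed.

Lemma monomial_spanM c1 c2 c3 f g :
  (forall m1 m2, c1 m1 -> c2 m2 -> c3 (mnm_add m1 m2)) ->
  monomial_span c1 f -> monomial_span c2 g -> monomial_span c3 (f * g).
Proof.
by move=> cM cf cg m /msuppM_le /allpairsP[[m1 m2] [/cf c1m /cg c2m ->]]; exact: cM.
Qed.

Lemma monomial_span_is_ideal c : (forall m k, c m -> c (mnm_add m k)) ->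
  is_ideal (monomial_span c).
Proof.
move=> cup; split.
- by move=> m; rewrite -mpolyC0 msupp0.
- by move=> f g cf cg m /msuppD_le; rewrite mem_cat => /orP[/cf|/cg].
- move=> f g cg; rewrite mulrC; apply: (monomial_spanM (c2 := predT)) cg _ => //.
  by move=> m1 m2 /cup.
Qed.

Lemma monomial_span_sub c (J : set (mpoly n K)) : is_ideal J ->
  (forall m, c m -> J (mpolyX K m)) -> monomial_span c `<=` J.
Proof.
move=> idJ cJ f cf; rewrite (mpolyE f); apply: ideal_sum_closed => // m /cf cm.
by rewrite -mul_mpolyC; case: idJ => _ _; apply; apply: cJ.
Qed.

(** Positive exactly on the monomials of the prime [P_i] generated by the variables other than
    [X_i]. *)
Definition deg_off (i : 'I_n) m := (\sum_(j | j != i) m j)%N.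

Lemma deg_offD i m k : deg_off i (mnm_add m k) = (deg_off i m + deg_off i k)%N.
Proof. by rewrite -big_split; apply: eq_bigr => j _; rewrite mnmDE. Qed.

Lemma deg_off_eq0 i m j : deg_off i m = 0%N -> j != i -> m j = 0%N.
Proof. by move=> /eqP; rewrite sum_nat_eq0 => /forallP/(_ j)/implyP h /h/eqP. Qed.

(* The extremal monomials of b and f for the lexicographic order
   (small deg_off, then large exponent of X_i) do not cancel in b * f. *)
Lemma monomial_span_primary i c b f :
  (forall m k, c m -> c (mnm_add m k)) ->
  (forall m k, deg_off i k = 0%N -> c (mnm_add m k) -> c m) ->
  ~ monomial_span (fun m => 0 < deg_off i m)%N b ->
  monomial_span c (b * f) -> monomial_span c f.
Proof.
move=> cup cdown bP cbf m0 m0f; apply/negPn/negP => ncm0.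
have /(seq_argmax (fun m => m i))[mb [mbb /eqP mb0 mbmax]] :
    has (fun m => deg_off i m == 0%N) (msupp b).
  apply/negPn/negP => /hasPn h; apply: bP => m mb.
  by rewrite lt0n (h m mb).
(* Only monomials of [f] outside [c] compete: [mf + mb] is then outside [c] as well and must not
   occur in [b * f]. *)
have /(seq_argmin (deg_off i))[m1 [m1f nc1 m1min]] : has (predC c) (msupp f).
  by apply/hasP; exists m0.
have /(seq_argmax (fun m => m i))[mf [mff /andP[ncf /eqP mfv] mfmax]] :
    has (fun m => ~~ c m && (deg_off i m == deg_off i m1)) (msupp f).
  by apply/hasP; exists m1 => //=; rewrite eqxx andbT.
have ncbf : ~~ c (mnm_add mf mb) by apply: contraNN ncf; exact: cdown.
have uniqp k1 k2 : k1 \in msupp b -> k2 \in msupp f ->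
    mnm_add mf mb = mnm_add k1 k2 -> k1 = mb /\ k2 = mf.
  move=> k1b k2f e.
  (* A [k2] in [c] would put [mf + mb] in [c]; so the minimality of [m1] applies to [k2]. *)
  have nc2 : ~~ c k2.
    by apply: contraNN ncbf; rewrite e addmC; exact: cup.
  have ev : (deg_off i mf + deg_off i mb = deg_off i k1 + deg_off i k2)%N.
    by rewrite -!deg_offD e.
  have v2 := m1min _ k2f nc2.
  have v1 : deg_off i k1 = 0%N by lia.
  have ei : (mf i + mb i = k1 i + k2 i)%N by rewrite -!mnmDE e.
  have i1 : (k1 i <= mb i)%N by apply: mbmax => //; apply/eqP.
  have i2 : (k2 i <= mf i)%N by apply: mfmax => //; rewrite nc2; apply/eqP; lia.
  have e1 : k1 = mb.
    apply/mnmP => j; have [->|ji] := eqVneq j i; first by lia.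
    by rewrite (deg_off_eq0 v1) // (deg_off_eq0 mb0).
  by split=> //; apply: (@addmI _ mb); rewrite [RHS]addmC e e1.
have : mcoeff (mnm_add mf mb) (b * f) = mcoeff mb b * mcoeff mf f.
  rewrite mpolyME raddf_sum big_allpairs /=.
  rewrite (bigD1_seq mb) ?msupp_uniq //= (bigD1_seq mf) ?msupp_uniq //=.
  rewrite mcoeffZ mcoeffX addmC eqxx mulr1.
  rewrite big_seq_cond big1 ?addr0 => [|k2 /andP[k2f ne2]]; last first.
    rewrite mcoeffZ mcoeffX; case: eqP => [e|]; rewrite ?mulr0 //.
    by have [_ e2] := uniqp mb k2 mbb k2f (esym e); rewrite e2 eqxx in ne2.
  rewrite big_seq_cond big1 ?addr0 // => k1 /andP[k1b ne1].
  rewrite big_seq_cond big1 ?addr0 // => k2 /andP[k2f _].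
  rewrite mcoeffZ mcoeffX; case: eqP => [e|]; rewrite ?mulr0 //.
  by have [e1 _] := uniqp k1 k2 k1b k2f (esym e); rewrite e1 eqxx in ne1.
move=> /eqP; apply/negP; rewrite (_ : mcoeff _ (b * f) = 0).
  by rewrite eq_sym mulf_neq0 // -mcoeff_msupp.
by apply/eqP; rewrite mcoeff_eq0; apply: contraNN ncbf => /cbf.
Qed.

(** Primality is the cancellation lemma above with [P_i] itself as the monomial ideal. *)
Lemma deg_off_prime i :
  is_prime_ideal (monomial_span (fun m => 0 < deg_off i m)%N).
Proof.
have up m k : (0 < deg_off i m)%N -> (0 < deg_off i (mnm_add m k))%N.
  by rewrite deg_offD; lia.
split; first exact: monomial_span_is_ideal.
  move=> /(_ mnm0); rewrite -mpolyC1 msupp1 inE eqxx => /(_ isT).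
  by rewrite /deg_off big1 // => j _; rewrite mnm0E.
move=> a b; have [|na] := pselect (monomial_span (fun m => 0 < deg_off i m)%N a).
  by left.
move=> ab; right; apply: monomial_span_primary na ab => // m k k0.
by rewrite deg_offD k0 addn0.
Qed.

End MonomialSpan.

(** * The ideal of all products [E_i E_j] and the numerical description of its monomials *)

Section CliqueIdeal.
Variables (n : nat) (K : fieldType) (w : 'I_n -> nat).
Hypothesis w_gt0 : forall i, (0 < w i)%N.
Implicit Types (m k : multinom n) (f b : mpoly n K) (y : 'I_n -> nat).

Definition clique_ideal : set (mpoly n K) :=
  ideal_gen [set f | exists i j, i != j /\ f = var K i ^+ w i * var K j ^+ w j].

Let I := clique_ideal.

(** The largest number of factors [X_j^w_j], [j != i], counted with multiplicity, whose product
    divides [X^m]. *)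
Definition quo_off i m := (\sum_(j | j != i) m j %/ w j)%N.

(* The exponent of the product of the powers [(X_j^w_j)^y_j]. *)
Definition wmnm y : multinom n := Multinom (mktuple (fun j => w j * y j)%N).

Lemma wmnmE y j : wmnm y j = (w j * y j)%N.
Proof. exact: mnmE. Qed.

Lemma quo_off_wmnm i m y :
  quo_off i (mnm_add (wmnm y) m) = (\sum_(j | j != i) y j + quo_off i m)%N.
Proof.
rewrite -big_split; apply: eq_bigr => j _.
by rewrite mnmDE wmnmE mulnC divnMDl.
Qed.

Lemma quo_offD i m k : (quo_off i m + quo_off i k <= quo_off i (mnm_add m k))%N.
Proof.
rewrite -big_split; apply: leq_sum => j _ /=.
by rewrite mnmDE leq_divRL // mulnDl leq_add // leq_trunc_div.
Qed.

(* The exponents of the monomials of the s-th symbolic power. *)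
Definition symb (s : nat) : pred (multinom n) :=
  [pred m | [forall i, s <= quo_off i m]%N].

Lemma symbP s m : reflect (forall i, (s <= quo_off i m)%N) (symb s m).
Proof. exact: forallP. Qed.

Lemma symbD s t m k : symb s m -> symb t k -> symb (s + t) (mnm_add m k).
Proof.
move=> /symbP sm /symbP tk; apply/symbP => i.
exact: leq_trans (leq_add (sm i) (tk i)) (quo_offD i m k).
Qed.

Lemma symb0 m : symb 0 m.
Proof. exact/symbP. Qed.

Lemma symb_up s m k : symb s m -> symb s (mnm_add m k).
Proof. by move=> sm; rewrite -[s]addn0; apply: symbD => //; exact: symb0. Qed.

Definition symb_span s : set (mpoly n K) := monomial_span (symb s).

Lemma symb_span_is_ideal s : is_ideal (symb_span s).
Proof. exact/monomial_span_is_ideal/symb_up. Qed.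

Lemma symb_span_ideal_mul s t (A B : set (mpoly n K)) :
  A `<=` symb_span s -> B `<=` symb_span t -> ideal_mul A B `<=` symb_span (s + t).
Proof.
move=> As Bt; apply: ideal_gen_sub; first exact: symb_span_is_ideal.
by move=> _ [a Aa] [c Bc <-]; apply: (monomial_spanM (@symbD s t)); [exact: As | exact: Bt].
Qed.

Lemma symb_span0 : symb_span 0 = setT.
Proof. by apply/seteqP; split=> // f _ m _; exact: symb0. Qed.

Lemma symb_span_ideal_exp s (r : nat) (A : set (mpoly n K)) :
  A `<=` symb_span s -> ideal_exp A r `<=` symb_span (s * r).
Proof.
move=> As; elim: r => [|r IHr]; first by rewrite muln0 symb_span0.
by rewrite mulnS; exact: symb_span_ideal_mul.
Qed.

Lemma var_expE (i : 'I_n) r : var K i ^+ r = mpolyX K (mnm_muln (mnm1 i) r).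
Proof. by rewrite mpolyXn. Qed.

Lemma var_wmnm i : var K i ^+ w i = mpolyX K (wmnm (fun j => i == j)).
Proof.
rewrite var_expE; congr mpolyX; apply/mnmP => j.
by rewrite wmnmE mulmnE mnm1E; case: eqP => [->|_]; rewrite ?mul1n ?muln1 ?muln0.
Qed.

Lemma sum_off_eq1 (i j : 'I_n) : j != i -> (\sum_(l | l != i) (j == l) = 1)%N.
Proof.
move=> ji; rewrite (bigD1 j) //= eqxx big1 ?addn0 // => l /andP[_].
by rewrite eq_sym => /negbTE ->.
Qed.

Lemma clique_ideal_sub : I `<=` symb_span 1.
Proof.
apply: ideal_gen_sub; first exact: symb_span_is_ideal.
move=> _ [i [j [ij ->]]]; rewrite !var_wmnm -mpolyXD; apply/monomial_spanX/symbP => l.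
rewrite quo_off_wmnm -(addm0 (wmnm _)) quo_off_wmnm addnA.
have [il|il] := eqVneq i l; last by rewrite sum_off_eq1.
by rewrite (@sum_off_eq1 l j) 1?eq_sym -?il //; lia.
Qed.

(* Multiplying by a power of [X_i] inverts it, so that the generators
   [X_i^w_i X_j^w_j] behave like the [X_j^w_j], [j != i]. *)
Lemma var_exp_clique_ideal i s m : (s <= quo_off i m)%N ->
  ideal_exp I s (var K i ^+ (w i * s) * mpolyX K m).
Proof.
elim: s m => [//|s IHs] m sm.
have [j /andP[ji jm]] : exists j, (j != i) && (0 < m j %/ w j)%N.
  apply/existsP; apply: contraTT sm => /existsPn h; rewrite -leqNgt /quo_off big1 // => j ji.
  by have := h j; rewrite ji -eqn0Ngt => /eqP.
have wm : (w j <= m j)%N by rewrite divn_gt0 in jm.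
pose k := mnm_sub m (mnm_muln (mnm1 j) (w j)).
have mE : m = mnm_add (wmnm (fun l => j == l)) k.
  apply/mnmP => l; rewrite mnmDE mnmBE wmnmE mulmnE mnm1E.
  by case: eqP => [<-|_]; lia.
have sk : (s <= quo_off i k)%N by move: sm; rewrite mE quo_off_wmnm sum_off_eq1.
rewrite {1}mE mpolyXD -var_wmnm mulnS exprD mulrACA.
apply: ideal_mul_mem (IHs k sk); apply: ideal_gen_mem.
by exists i, j; rewrite eq_sym.
Qed.

(** For [n = 0] the condition over all [i] is vacuous and the right side is the whole ring, whence
    [0 < n]. *)
Lemma clique_idealE : (0 < n)%N -> I = symb_span 1.
Proof.
move=> n_gt0; apply/seteqP; split; first exact: clique_ideal_sub.
apply: monomial_span_sub; first exact: ideal_gen_is_ideal.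
move=> m /symbP m1.
have pos i : (0 < quo_off i m)%N -> exists2 j, j != i & (w j <= m j)%N.
  move=> /= h; have : [exists j, (j != i) && (w j <= m j)%N].
    apply: contraTT h => /existsPn h; rewrite -eqn0Ngt /quo_off big1 // => j ji.
    by have := h j; rewrite ji /= -ltnNge => /divn_small.
  by move=> /existsP[j /andP[]]; exists j.
(* The condition at an arbitrary vertex gives one divisor [X_i^w_i]; the condition at this [i] gives
   a second one with [j != i]. *)
have [i _ wi] := pos _ (m1 (Ordinal n_gt0)).
have [j ji wj] := pos _ (m1 i).
pose u := mnm_add (wmnm (fun l => i == l)) (wmnm (fun l => j == l)).
have -> : m = mnm_add (mnm_sub m u) u.
  apply/mnmP => l; rewrite !(mnmDE, mnmBE, wmnmE).
  have [jl|_] := eqVneq j l; have [il|_] := eqVneq i l; subst; rewrite ?eqxx in ji *; lia.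
rewrite mpolyXD; have [_ _ IM] := ideal_gen_is_ideal
  [set f | exists i j, i != j /\ f = var K i ^+ w i * var K j ^+ w j].
apply: IM; apply: ideal_gen_mem; exists i, j; rewrite eq_sym; split => //.
by rewrite mpolyXD !var_wmnm.
Qed.

Lemma deg_off_quo_off i m k : deg_off i k = 0%N -> quo_off i (mnm_add m k) = quo_off i m.
Proof.
move=> k0; apply: eq_bigr => j ji.
by rewrite mnmDE (deg_off_eq0 k0) // addn0.
Qed.

(** * Associated primes and symbolic powers of the clique ideal *)

Lemma deg_off_assoc_prime i :
  assoc_primes I (monomial_span (fun m => 0 < deg_off i m)%N).
Proof.
have n_gt0 : (0 < n)%N by exact: leq_trans (ltn_ord i).
split; first exact: deg_off_prime.
(* Among the [X_j^w_j] only [X_i^w_i] divides [X^u]. Any further [X_j] with [j != i] completes a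
   second factor, while powers of [X_i] never do, so [P_i] is the annihilator of [X^u] modulo
   [I]. *)
pose u : multinom n := Multinom (mktuple (fun j => if j == i then w j else (w j).-1)).
have uE j : u j = if j == i then w j else (w j).-1 by exact: mnmE.
exists (mpolyX K u); rewrite clique_idealE //.
have uP m : symb 1 (mnm_add m u) = (0 < deg_off i m)%N.
  apply/symbP/idP => [/(_ i)|].
    apply: contraTT; rewrite -eqn0Ngt => /eqP m0; rewrite addmC (deg_off_quo_off _ m0).
    rewrite /quo_off big1 // => j ji; rewrite uE (negbTE ji) divn_small //.
    by rewrite prednK.
  move=> mi l; have [j /andP[ji jm]] : exists j, (j != i) && (0 < m j)%N.
    apply/existsP; apply: contraTT mi => /existsPn h; rewrite -eqn0Ngt /deg_off big1 // => j ji.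
    by have := h j; rewrite ji -eqn0Ngt => /eqP.
  have [il|il] := eqVneq i l.
    rewrite /quo_off (bigD1 j) -?il //= mnmDE uE (negbTE ji) addn_gt0 divn_gt0 //.
    by rewrite -[X in (X <= _)%N]prednK // -addn1 addnC leq_add.
  rewrite /quo_off (bigD1 i) //= mnmDE uE eqxx addn_gt0 divn_gt0 //.
  by rewrite leq_addl.
apply/seteqP; split=> f /= fP.
  apply: (monomial_spanM _ fP); last exact: (proj2 (monomial_spanX K (pred1 u) u) (eqxx _)).
  by move=> m1 m2 m1P /eqP ->; rewrite uP.
move=> m mf; rewrite -uP; apply: fP.
by rewrite addmC mcoeff_msupp mcoeffMX -mcoeff_msupp.
Qed.

(** Suppose [p], the annihilator of [f], contains every variable. As [X_i] does not affect
    [quo_off i], membership of [X_i * f] in [I] gives the condition at [i] for [f]; all [i] together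
    put [f] in [I], so [p] contains 1. *)
Lemma assoc_prime_var p : (0 < n)%N -> assoc_primes I p -> exists i, ~ p (var K i).
Proof.
move=> n_gt0 [[idp p1 _] [f pE]]; apply: contrapT => nex.
have all_p i : p (var K i) by apply: contrapT => ni; apply: nex; exists i.
suff fI : I f by apply: p1; rewrite pE /= mul1r.
rewrite clique_idealE // => m mf; apply/symbP => i.
have : symb 1 (mnm_add m (mnm1 i)).
  have := all_p i; rewrite pE /= clique_idealE //; apply.
  by rewrite mulrC addmC mcoeff_msupp mcoeffMX -mcoeff_msupp.
move=> /symbP/(_ i); rewrite deg_off_quo_off // /deg_off big1 // => j ji.
by rewrite mnm1E eq_sym (negbTE ji).
Qed.

(** The primes [P_i] force the conditions one by one. Conversely, every associated prime misses some
    [X_i], a power of which carries [symb_span s] into the ordinary power. *)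
Lemma symbolic_powerE s : (0 < n)%N -> symbolic_power I s = symb_span s.
Proof.
move=> n_gt0; have idIs := ideal_exp_is_ideal I s.
apply/seteqP; split=> f fP.
  move=> m mf; apply/symbP => i.
  have /loc_contractionP := fP _ (deg_off_assoc_prime i).
  move=> /(_ idIs (deg_off_prime _ i))[b nb bf].
  (* Only the condition at [i] is kept here: it is insensitive to powers of [X_i], as the
     cancellation lemma demands. *)
  have c_up m1 k : (s <= quo_off i m1)%N -> (s <= quo_off i (mnm_add m1 k))%N.
    by have := quo_offD i m1 k; lia.
  apply: (@monomial_span_primary n K i (fun m => s <= quo_off i m)%N b f) mf => //.
    by move=> m1 k k0; rewrite deg_off_quo_off.
  have Is : ideal_exp I s `<=` symb_span s.
    rewrite -[X in symb_span X]mul1n; apply: symb_span_ideal_exp.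
    exact: clique_ideal_sub.
  by move=> m1 /(Is _ bf)/symbP.
move=> p pI; have [i pi] := assoc_prime_var n_gt0 pI.
have [pp _] := pI; apply/loc_contractionP => //.
exists (var K i ^+ (w i * s)).
  case: pp => _ p1 pM; elim: (w i * s)%N => [|k IHk]; first by rewrite expr0.
  by rewrite exprS => /pM[].
apply: (@monomial_span_sub n K (symb s) [set f | ideal_exp I s (var K i ^+ (w i * s) * f)]) fP.
  have [I0 ID IM] := idIs; split=> [|a b|r a] /=; first by rewrite mulr0.
    by rewrite mulrDr; exact: ID.
  by rewrite mulrCA; exact: IM.
by move=> m /symbP sm; exact: var_exp_clique_ideal.
Qed.

(** * Factoring monomials of symbolic powers into products over vertex sets *)

Lemma symb_wmnm_set (T : {set 'I_n}) t : #|T| = t.+1 -> symb t (wmnm (fun j => j \in T)).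
Proof.
move=> cT; apply/symbP => i; rewrite -(addm0 (wmnm _)) quo_off_wmnm.
rewrite -big_mkcondr /= sum1_card; apply: leq_trans (leq_addr _ _).
rewrite -ltnS -cT (cardD1 i T); rewrite -[in X in (_ <= X)%N]add1n.
apply: leq_add; first by case: (i \in T).
by apply: eq_leq; apply: eq_card => j; rewrite !inE andbC.
Qed.

Lemma symb_peel s m : (0 < n)%N -> (0 < s)%N -> symb s m ->
  exists t (T : {set 'I_n}) k,
  [/\ (0 < t <= s)%N, #|T| = t.+1, m = mnm_add (wmnm (fun j => j \in T)) k & symb (s - t) k].
Proof.
move=> n_gt0 s_gt0 /symbP sm.
pose y j := (m j %/ w j)%N; pose S := [set j | (0 < y j)%N]%SET.
have sub (T : {set 'I_n}) : T \subset S -> exists k, m = mnm_add (wmnm (fun j => j \in T)) k.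
  move=> /fintype.subsetP TS; exists (mnm_sub m (wmnm (fun j => j \in T))).
  apply/mnmP => j; rewrite mnmDE mnmBE wmnmE.
  have [jT|_] := boolP (j \in T); last by lia.
  by have := TS j jT; rewrite inE /y divn_gt0 // muln1; lia.
have pos i : exists2 j, j != i & j \in S.
  have : [exists j, (j != i) && (j \in S)].
    apply: contraTT (leq_trans s_gt0 (sm i)) => /existsPn h.
    rewrite -eqn0Ngt /quo_off big1 // => j ji.
    by have := h j; rewrite ji inE -eqn0Ngt => /eqP.
  by move=> /existsP[j /andP[]]; exists j.
have [i _ iS] := pos (Ordinal n_gt0); have [j ji jS] := pos i.
have S1 : (1 < #|S|)%N.
  by rewrite (cardD1 i) iS (cardD1 j) !inE ji; rewrite inE in jS; rewrite jS.
(* With more than [s] elements in [S], a subset of size [s + 1] uses up all of [s] at once. *)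
have [sS|Ss] := ltnP s #|S|.
  have [T TS cT] : exists2 T : {set 'I_n}, T \subset S & #|T| = s.+1.
    have /card_gt0P[T] :
        (0 < #|[set T : {set 'I_n} | (T \subset S) && (#|T| == s.+1)]%SET|)%N.
      by rewrite cards_draws bin_gt0.
    by rewrite inE => /andP[TS /eqP cT]; exists T.
  have [k mE] := sub T TS; exists s, T, k; rewrite s_gt0 leqnn subnn; split=> //.
  exact: symb0.
have [k mE] := sub S (fintype.subxx _); exists #|S|.-1, S, k.
split=> //; [by apply/andP; lia | by rewrite prednK // ltnW |].
apply/symbP => l.
have qE i' : quo_off i' m = (\sum_(j | j != i') (j \in S) + quo_off i' k)%N.
  by rewrite {1}mE quo_off_wmnm.
have cS i' : (#|S| = (i' \in S) + \sum_(j | j != i') (j \in S))%N.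
  by rewrite -sum1_card big_mkcond (bigD1 i') //=.
(* For [l] in [S], [quo_off l] drops by exactly [#|S| - 1]. *)
have [lS|lS] := boolP (l \in S).
  by have := sm l; rewrite qE; have := cS l; rewrite lS; lia.
(* For [l] outside [S] the drop is [#|S|], one more. But [y l = 0] makes [quo_off l m] the full sum
   of [y], which exceeds [quo_off i m >= s] by [y i > 0]. *)
have total i' : (\sum_j y j = y i' + quo_off i' m)%N by rewrite (bigD1 i').
have := total l; have := total i; rewrite (_ : y l = 0)%N; last first.
  by apply/eqP; rewrite inE -eqn0Ngt in lS.
have yi : (0 < y i)%N by rewrite inE in iS.
by have := sm i; have := cS l; have := qE l; rewrite (negbTE lS); lia.
Qed.

(** Repeated peeling brings [s] down to 0; [r] counts how often each drop occurs. *)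
Lemma symb_span_rees s : (1 < n)%N ->
  symb_span s =
  ideal_sum
    [set r : 'I_n.-1 -> nat | s = (\sum_(i < n.-1) i.+1 * r i)%N]
    (fun r => \big[@ideal_mul (mpoly n K)/setT]_(i < n.-1)
       ideal_exp (symb_span i.+1) (r i)).
Proof.
move=> n_gt1; apply/seteqP; split; last first.
  apply: ideal_gen_sub; first exact: symb_span_is_ideal.
  have sub (r : 'I_n.-1 -> nat) :
      \big[@ideal_mul (mpoly n K)/setT]_(i < n.-1) ideal_exp (symb_span i.+1) (r i) `<=`
      symb_span (\sum_(i < n.-1) i.+1 * r i)%N.
    apply: (big_ind2 (fun (A : set (mpoly n K)) (t : nat) => A `<=` symb_span t)).
    - by rewrite symb_span0.
    - by move=> A1 s1 A2 s2; exact: symb_span_ideal_mul.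
    - by move=> i _; exact: symb_span_ideal_exp.
  by move=> f [r ->]; exact: sub.
have idS := ideal_gen_is_ideal.
apply: monomial_span_sub; first exact: ideal_gen_is_ideal.
move=> m sm.
(* One element [x i] is collected per power of ideals; [h] is the monomial left once [s] has reached
   0. *)
suff [h [r [x [sE xP ->]]]] : exists h (r : 'I_n.-1 -> nat) (x : 'I_n.-1 -> mpoly n K),
    [/\ s = (\sum_(i < n.-1) i.+1 * r i)%N,
        forall i : 'I_n.-1, ideal_exp (symb_span i.+1) (r i) (x i) &
        mpolyX K m = h * \prod_i x i].
  have [_ _ IM] := idS _
    (\bigcup_(r in [set r : 'I_n.-1 -> nat | s = (\sum_(i < n.-1) i.+1 * r i)%N])
    \big[@ideal_mul (mpoly n K)/setT]_(i < n.-1) ideal_exp (symb_span i.+1) (r i)).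
  apply: IM; apply: ideal_gen_mem; exists r => //.
  apply: (big_ind2 (fun (A : set (mpoly n K)) a => A a)) => // A a B b' Aa Bb.
  exact: ideal_mul_mem.
have [N] := ubnP s; elim: N s m sm => // N IHN s m sm sN.
have [->|s_gt0] := posnP s.
  exists (mpolyX K m), (fun=> 0%N), (fun=> 1); split=> //.
    by rewrite big1 // => i _; rewrite muln0.
  by rewrite big1 // mulr1.
have [t [T [k [/andP[t_gt0 ts] cT -> sk]]]] := symb_peel (ltnW n_gt1) s_gt0 sm.
have [|h [r [x [sE xP XE]]]] := IHN _ _ sk; first by lia.
(* From [t + 1 = #|T| <= n]. The index is [t - 1] because position [i] stands for the symbolic power
   [i + 1]. *)
have tn : (t.-1 < n.-1)%N.
  by have := max_card (mem T); rewrite cT card_ord; lia.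
pose i0 := Ordinal tn.
exists h, (fun i => (i == i0) + r i)%N.
exists (fun i => (if i == i0 then mpolyX K (wmnm (fun j => j \in T)) else 1) * x i).
split.
- under eq_bigr do rewrite mulnDr.
  rewrite big_split -sE (bigD1 i0) //= eqxx big1 ?addn0 /=; last first.
    by move=> i /negbTE ->; rewrite muln0.
  by lia.
- move=> i; case: eqP => [->|_]; last by rewrite mul1r.
  rewrite add1n; apply: ideal_mul_mem (xP i0); apply/monomial_spanX.
  by apply: symb_wmnm_set; rewrite prednK.
- rewrite big_split /= -big_mkcond big_pred1_eq mpolyXD XE.
  by rewrite mulrCA.
Qed.

End CliqueIdeal.

Arguments clique_ideal {n} K w.
Arguments symb_span {n} K w s.

(** * Complete graphs whose vertices of weight greater than 1 are sinks *)

Section CompleteSinks.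
Variables (n : nat) (D : wograph n).
Hypothesis Dcomplete : is_complete D.
Hypothesis Vplus_sinks : forall x, x \in Vplus D -> is_sink D x.

Lemma arc_tail_weight x y : arc D x y -> weight D x = 1%N.
Proof.
move=> xy; apply/eqP/negPn/negP => wx.
by have /Vplus_sinks/(_ y) : x \in Vplus D; [rewrite inE | rewrite xy].
Qed.

Lemma edge_idealE (K : fieldType) : edge_ideal D K = clique_ideal K (weight D).
Proof.
apply/seteqP; split; apply: ideal_gen_sub; try exact: ideal_gen_is_ideal.
  move=> _ [x [y [xy ->]]]; apply: ideal_gen_mem; exists x, y.
  by split; [apply: contraTneq xy => ->; rewrite arc_irrefl | rewrite (arc_tail_weight xy)].
move=> _ [x [y [/Dcomplete/orP xy ->]]]; apply: ideal_gen_mem.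
case: xy => [xy|yx]; [exists x, y | exists y, x; rewrite mulrC].
  by rewrite (arc_tail_weight xy).
by rewrite (arc_tail_weight yx).
Qed.

(** The edge between [x] and the sink [z] must leave [x], and tails of arcs have weight 1. *)
Lemma Vplus_unique x z : z \in Vplus D -> x != z -> weight D x = 1%N.
Proof.
move=> zV /Dcomplete/orP[/arc_tail_weight //|zx].
by have := Vplus_sinks zV x; rewrite zx.
Qed.

End CompleteSinks.

(** * Smallest degrees of monomial ideals *)

Lemma alphaE n (K : fieldType) (I : set (mpoly n K)) d :
  has_degree I d -> (forall e, has_degree I e -> (d <= e)%N) -> alpha I = d.
Proof.
move=> Id dmin; rewrite /alpha; case: pselect => [h|[]]; last first.
  by exists d; apply/asboolP.
case: ex_minnP => e /asboolP Ie emin; apply/eqP; rewrite eqn_leq dmin // andbT.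
by apply: emin; apply/asboolP.
Qed.

(** The leading monomial of a homogeneous element has the same degree and satisfies [c], so
    monomials decide the minimum. *)
Lemma alpha_monomial_span n (K : fieldType) (c : pred (multinom n)) m :
  c m -> (forall k, c k -> (mdeg m <= mdeg k)%N) ->
  alpha (monomial_span (K := K) c) = mdeg m.
Proof.
move=> cm mmin; apply: alphaE.
  exists (mpolyX K m); split; [exact/monomial_spanX| |by rewrite dhomogX].
  by rewrite -msupp_eq0 msuppX.
move=> e [f [cf f0 /dhomogP fe]].
by rewrite -(fe _ (mlead_supp f0)); apply/mmin/cf/mlead_supp.
Qed.

(** Units are placed one at a time: below the total capacity, some place in [P] still has room. *)
Lemma exists_bounded_sum (T : finType) (P : pred T) q a : (a <= #|P| * q)%N ->
  exists y : T -> nat, [/\ forall i, (y i <= q)%N, forall i, ~~ P i -> y i = 0%N &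
    (\sum_i y i = a)%N].
Proof.
elim: a => [_|a IHa ltaq]; first by exists (fun=> 0%N); rewrite big1.
have [y [yq yP ya]] := IHa (ltnW ltaq).
have /existsP[i /andP[Pi yi]] : [exists i, P i && (y i < q)%N].
  apply: contraTT ltaq => /existsPn h; rewrite -leqNgt -ya -sum_nat_const.
  rewrite [leqRHS](bigID P) /= -[leqLHS]addn0 leq_add // leq_sum // => i Pi.
  by rewrite leqNgt; have := h i; rewrite [P i]Pi.
exists (fun j => (i == j) + y j)%N; split.
- by move=> j; case: eqP => [<-|_]; [exact: yi | exact: yq].
- by move=> j; case: eqP => [<-|_]; [rewrite [P i]Pi | exact: yP].
- by rewrite big_split /= ya (bigD1 i) //= eqxx big1 ?addn0 // => j; rewrite eq_sym => /negbTE ->.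
Qed.

(** * Degree bounds with a single vertex of weight greater than 1 *)

Section OneWeight.
Variables (n : nat) (w : 'I_n -> nat) (z : 'I_n).
Hypothesis n_gt2 : (2 < n)%N.
Hypothesis wz : (1 < w z)%N.
Hypothesis w1 : forall x, x != z -> w x = 1%N.

Lemma quo_off_z (m : multinom n) : quo_off w z m = deg_off z m.
Proof. by apply: eq_bigr => j jz; rewrite w1 // divn1. Qed.

(** The sum of all [m j %/ w j], split once at [i] and once at [z]. *)
Lemma quo_off_deg (m : multinom n) i : i != z ->
  (quo_off w i m + m i = deg_off z m + m z %/ w z)%N.
Proof.
move=> iz; have total l : (\sum_j m j %/ w j = m l %/ w l + quo_off w l m)%N by rewrite (bigD1 l).
by have := total i; rewrite (total z) quo_off_z (w1 iz) divn1; lia.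
Qed.

Lemma mdeg_deg_off (m : multinom n) : mdeg m = (m z + deg_off z m)%N.
Proof. by rewrite mdegE (bigD1 z). Qed.

(** A division-free form of [q >= ceil(s / (n - 2))] for the excess [q] of the degree over [s]. *)
Lemma symb_mdeg s m : symb w s m -> exists2 q, mdeg m = (s + q)%N & (s <= q * (n - 2))%N.
Proof.
move=> /symbP sm.
have := sm z; rewrite quo_off_z => sA.
set c := (m z %/ w z)%N.
have c2 : (2 * c <= m z)%N.
  by apply: leq_trans (leq_trunc_div (m z) (w z)); rewrite mulnC leq_mul.
have card : #|[pred i | i != z]| = n.-1 by have := cardC1 z; rewrite card_ord.
have H : (n.-1 * s + deg_off z m <= n.-1 * (deg_off z m + c))%N.
  rewrite -card -!sum_nat_const -big_split; apply: leq_sum => i iz /=.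
  by rewrite -(quo_off_deg m iz) leq_add2r.
exists (mdeg m - s)%N; rewrite mdeg_deg_off; first by lia.
have [u uE] : exists u, deg_off z m = (s + u)%N by exists (deg_off z m - s)%N; lia.
(* Now [H] reads [s <= (n-2) u + (n-1) c], and [(n-1) c <= (n-2) m_z] because [2 c <= m_z] and
   [n - 1 <= 2 (n-2)]. Writing [n = N + 3] removes the truncated subtractions. *)
have [N [NE ->]] : exists N, n.-1 = N.+2 /\ (n - 2 = N.+1)%N by exists (n - 3)%N; lia.
by move: H; rewrite uE NE; nia.
Qed.

(** The [n - 1] vertices other than [z] can hold [s + q] with at most [q] each, since
    [(n-1) q >= s + q]. Leaving out any one of them then leaves at least [s]. *)
Lemma symb_attained s q : (s <= q * (n - 2))%N -> exists2 m, symb w s m & mdeg m = (s + q)%N.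
Proof.
move=> sq; have card : #|[pred i | i != z]| = n.-1 by have := cardC1 z; rewrite card_ord.
have [|y [yq yz ysum]] := @exists_bounded_sum _ [pred i | i != z] q (s + q).
  by rewrite card; nia.
pose m : multinom n := Multinom (mktuple y).
have mE j : m j = y j by exact: mnmE.
have mz : m z = 0%N by rewrite mE yz //= negbK.
have md : mdeg m = (s + q)%N.
  by rewrite mdegE -ysum; apply: eq_bigr => j _; rewrite mE.
exists m => //; apply/symbP => i.
have := mdeg_deg_off m; rewrite md mz add0n => dE.
have [->|iz] := eqVneq i z; first by rewrite quo_off_z -dE leq_addr.
by have := quo_off_deg m iz; have := yq i; rewrite mz div0n -dE mE; lia.
Qed.

(** The two inequalities say that [q] is [ceil(s / (n - 2))]. *)
Lemma alpha_symb_span (K : fieldType) s q :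
  (s <= q * (n - 2))%N -> (q * (n - 2) < s + (n - 2))%N -> alpha (symb_span K w s) = (s + q)%N.
Proof.
move=> sq qs; have [m sm mE] := symb_attained sq; rewrite -mE.
apply: alpha_monomial_span => // k /symb_mdeg[r -> sr]; rewrite mE leq_add2l.
rewrite -ltnS -(@ltn_pmul2r (n - 2)) ?subn_gt0 // mulSn; lia.
Qed.

End OneWeight.

(** * Ceilings and the limit of the quotients *)

Lemma ceil_ratE (s q d : nat) : (0 < d)%N -> (s <= q * d)%N -> (q * d < s + d)%N ->
  Num.ceil (s%:R / d%:R : rat) = q.
Proof.
move=> d_gt0 sq qs; apply: ceil_def; have d0 : 0 < d%:R :> rat by rewrite ltr0n.
rewrite ltr_pdivlMr // ler_pdivrMr // rmorphB /= mulrBl mul1r ltrBlDr.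
have := qs; have := sq; rewrite -(ler_nat rat) -(ltr_nat rat) natrD !natrM.
by rewrite -!pmulrn => -> ->.
Qed.

(** A squeeze: [q / s] lies between [1 / d] and [1 / d + 1 / s]. *)
Lemma ratio_cvg (R : realType) (d : nat) (a : nat -> nat) : (0 < d)%N ->
  (forall s, (0 < s)%N -> exists q, [/\ a s = (s + q)%N, (s <= q * d)%N & (q * d < s + d)%N]) ->
  (fun s => (a s)%:R / s%:R : R) @ \oo --> (1 + d%:R^-1 : R).
Proof.
move=> d_gt0 aP; have d0 : 0 < d%:R :> R by rewrite ltr0n.
(* The shift discards [s = 0], where the quotient is a division by zero, and turns the error [1 / s]
   into [harmonic]. *)
rewrite -cvg_shiftS.
apply: (@squeeze_cvgr _ _ _ _ (fun=> 1 + d%:R^-1) (fun s => 1 + d%:R^-1 + harmonic s)).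
- apply: nearW => s /=; have [//|q [-> sq qs]] := aP s.+1.
  have s0 : 0 < s.+1%:R :> R by rewrite ltr0n.
  rewrite natrD mulrDl divff ?gt_eqF // -!addrA !lerD2l /harmonic /=.
  apply/andP; split.
    rewrite -[_^-1]mul1r ler_pdivrMr // mulrAC ler_pdivlMr // mul1r.
    by rewrite -natrM ler_nat.
  rewrite ler_pdivrMr // mulrDl mulVf ?gt_eqF // -(ler_pM2r d0).
  rewrite mulrDl mul1r mulrAC mulVf ?gt_eqF // mul1r -natrM -natrD ler_nat.
  exact: ltnW.
- exact: cvg_cst.
- rewrite -[X in _ --> X]addr0; apply: cvgD; first exact: cvg_cst.
  exact: cvg_harmonic.
Qed.

(** * Symbolic powers and Waldschmidt constant of the edge ideal *)

Theorem proposition3p10 (R : realType) (K : fieldType) (n : nat) (D : wograph n)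
    (Dcomplete : is_complete D)
    (Vplus_neq0 : Vplus D != finset.set0)
    (Vplus_sinks : forall x, x \in Vplus D -> is_sink D x) :
  let I : set (mpoly n K) := edge_ideal D K in
  (forall s : nat, (n <= s)%N ->
     symbolic_power I s =
     ideal_sum
       [set r : 'I_n.-1 -> nat | s = (\sum_(i < n.-1) i.+1 * r i)%N]
       (fun r => \big[@ideal_mul (mpoly n K)/setT]_(i < n.-1)
          ideal_exp (if i.+1 == 1%N then I else symbolic_power I i.+1) (r i)))
  /\
  ((3 <= n)%N ->
     (forall s : nat, (0 < s)%N ->
        (alpha (symbolic_power I s))%:Z =
        s%:Z + Num.ceil (s%:R / (n - 2)%:R : rat))
     /\ cvgn (waldschmidt_seq R I)
     /\ waldschmidt R I = (n - 1)%:R / (n - 2)%:R).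
Proof.
move=> I; have /set0Pn[z zV] := Vplus_neq0.
have IE : I = clique_ideal K (weight D) by exact: edge_idealE.
have wz : (1 < weight D z)%N.
  by have := weight_gt0 D z; move: zV; rewrite inE; lia.
(* Sources have weight 1, so some arc enters [z]; its tail is a second vertex. *)
have n_gt1 : (1 < n)%N.
  have [y yz] : exists y, arc D y z.
    apply: contrapT => noarc; move: wz; rewrite weight_source // => y.
    by apply/negP => yz; apply: noarc; exists y.
  have /negP ne : y != z by apply: contraTneq yz => ->; rewrite arc_irrefl.
  rewrite ltnNge; apply/negP => n1; apply: ne; apply/eqP/val_inj => /=.
  by move: (ltn_ord y) (ltn_ord z); lia.
have n_gt0 := ltnW n_gt1.
have symE s : symbolic_power I s = symb_span K (weight D) s.
  by rewrite IE; apply: symbolic_powerE => //; exact: weight_gt0.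
split=> [s _|n_gt2].
  rewrite symE (symb_span_rees K (@weight_gt0 n D) s n_gt1); congr ideal_sum.
  apply/funext => r; apply: eq_bigr => i _; rewrite -symE; congr ideal_exp.
  (* At index 1 the summand uses [I], which equals its first symbolic power. *)
  case: eqP => [[->]|//]; rewrite symE IE; apply/esym/clique_idealE => //.
  exact: weight_gt0.
(* The ceiling of [s / (n - 2)] as a Euclidean quotient. *)
pose q s := ((s + (n - 2).-1) %/ (n - 2))%N.
have d_gt0 : (0 < n - 2)%N by rewrite subn_gt0.
have qP s : (s <= q s * (n - 2) < s + (n - 2))%N.
  have := divn_eq (s + (n - 2).-1) (n - 2); have := ltn_pmod (s + (n - 2).-1) d_gt0.
  by rewrite -/(q s); lia.
have alphaI s : alpha (symbolic_power I s) = (s + q s)%N.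
  have /andP[sq qs] := qP s.
  rewrite symE; apply: (alpha_symb_span n_gt2 wz) sq qs => x xz.
  exact: (Vplus_unique Dcomplete Vplus_sinks zV).
split=> [s _|].
  have /andP[sq qs] := qP s.
  by rewrite alphaI PoszD (ceil_ratE d_gt0 sq qs).
have cvgI : waldschmidt_seq R I @ \oo --> ((n - 1)%:R / (n - 2)%:R : R).
  have -> : ((n - 1)%:R / (n - 2)%:R = 1 + (n - 2)%:R^-1 :> R).
    rewrite (_ : n - 1 = (n - 2).+1)%N; last by lia.
    by rewrite -natr1 mulrDl mul1r divff // pnatr_eq0 -lt0n.
  apply: ratio_cvg => // s _; exists (q s).
  by have /andP[] := qP s.
split; first by apply/cvg_ex; exists ((n - 1)%:R / (n - 2)%:R).
exact: cvg_lim cvgI.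
Qed.
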